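(* Let $\{(x_j,y_j)\}_{j=1}^m\subset\mathbb{R}^d\times\mathbb{R}$ be the training data and let $N,K\ge 1$ be integers with $K\ge m$. Let $\phi_1,\dots,\phi_K\in C^1(\mathbb{R})$ be such that for any $m$ distinct points $z_1,\dots,z_m\in\mathbb{R}$ the $K\times m$ matrix with $(k,j)$-entry $\phi_k(z_j)$ has full rank. Let $c_1,\dots,c_N$ be initialized independently from a continuous probability distribution on $\mathbb{R}$ symmetric around $0$, and let $v_i=[w_i;b_i]\in\mathbb{R}^{d+1}$, $1\le i\le N$, be initialized independently from the normal distribution $N(0,I_{d+1})$. The feed-forward network is initialized with $\Theta_{FF}(0)=\{c_i,w_i,b_i\}_{i=1}^N$, and the Kronecker network is initialized with the same $\{c_i,w_i,b_i\}_{i=1}^N$ together with $\omega(0)=(1,1,\dots,1)\in\mathbb{R}^K$ and $\alpha(0)=(1,0,\dots,0)\in\mathbb{R}^K$ (so that $L^{\mathcal K}(0)=L^{\mathrm{FF}}(0)$). Then, with probability $1$ over the initialization, there exists $T>0$ such that $$L^{\mathcal K}(t)<L^{\mathrm{FF}}(t)\qquad\text{for all } t\in(0,T).$$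
   Context: The two-layer feed-forward network with parameters $\Theta_{FF}=\{c_i,w_i,b_i\}_{i=1}^N$ ($c_i,b_i\in\mathbb{R}$, $w_i\in\mathbb{R}^d$) is $$u^{\mathrm{FF}}_{\Theta_{FF}}(x)=\sum_{i=1}^N c_i\,\phi_1(w_i^Tx+b_i),\qquad x\in\mathbb{R}^d.$$ The two-layer Kronecker network with parameters $\Theta_{\mathcal K}=\{c_i,w_i,b_i\}_{i=1}^N\cup\{\alpha_k,\omega_k\}_{k=1}^K$ ($\alpha_k,\omega_k\in\mathbb{R}$) is $$u^{\mathcal K}_{\Theta_{\mathcal K}}(x)=\sum_{i=1}^N c_i\Big[\sum_{k=1}^K\alpha_k\,\phi_k\big(\omega_k(w_i^Tx+b_i)\big)\Big].$$ For either network $u_\Theta$ the square loss is $L(\Theta)=\frac12\sum_{j=1}^m(u_\Theta(x_j)-y_j)^2$. All parameters of the respective network ($\Theta_{FF}$ for the feed-forward network, $\Theta_{\mathcal K}$ for the Kronecker network) evolve by the gradient flow $$\dot\Theta(t)=-\nabla_\Theta L(\Theta(t)),\quad t\ge 0,\qquad \Theta(0)=\text{the given initialization}.$$ $L^{\mathrm{FF}}(t)$ and $L^{\mathcal K}(t)$ denote the loss $L(\Theta(t))$ along the gradient flow of the feed-forward network and of the Kronecker network, respectively.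
   Formalization: Added hypothesis: at some input x_j the labels y_l over all l with x_l = x_j have nonzero sum, or the zero set of φ_1 has Lebesgue measure zero. Without it the claim fails, e.g. m=1, K=2, φ_1=0, φ_2=1, y_1=0, where L^FF is identically 0. *)

(* Defs.v *)
From HB Require Import structures.
From mathcomp Require Import all_boot all_order all_algebra.
From mathcomp Require Import all_classical all_reals all_analysis.
Set Implicit Arguments.
Unset Strict Implicit.
Unset Printing Implicit Defensive.
Import Order.TTheory GRing.Theory Num.Theory.
Import numFieldNormedType.Exports.
Local Open Scope classical_set_scope.
Local Open Scope ring_scope.

(* A parameter set is one row vector, so that the gradient with respect to all
   parameters is a gradient on a Euclidean space: Theta_FF is [c | w | b], with
   the N x d matrix w (row i is w_i^T) flattened by mxvec, and Theta_K is
   [Theta_FF | alpha | omega]. *)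
Section networks.
Context {R : realType} (N d : nat).

Definition ff_c (th : 'rV[R]_(N + (N * d + N))) : 'rV[R]_N := lsubmx th.

Definition ff_w (th : 'rV[R]_(N + (N * d + N))) : 'M[R]_(N, d) :=
  vec_mx (lsubmx (rsubmx th)).

Definition ff_b (th : 'rV[R]_(N + (N * d + N))) : 'rV[R]_N :=
  rsubmx (rsubmx th).

Definition preactivation (th : 'rV[R]_(N + (N * d + N))) (i : 'I_N)
    (x : 'cV[R]_d) : R :=
  (ff_w th *m x) i 0 + ff_b th 0 i.

Definition ff_net (phi1 : R -> R) (th : 'rV[R]_(N + (N * d + N)))
    (x : 'cV[R]_d) : R :=
  \sum_(i < N) ff_c th 0 i * phi1 (preactivation th i x).

Definition kron_net (K : nat) (phi : 'I_K -> R -> R)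
    (th : 'rV[R]_(N + (N * d + N) + (K + K))) (x : 'cV[R]_d) : R :=
  let alpha := lsubmx (rsubmx th) in
  let omega := rsubmx (rsubmx th) in
  \sum_(i < N) ff_c (lsubmx th) 0 i *
    \sum_(k < K) alpha 0 k *
      phi k (omega 0 k * preactivation (lsubmx th) i x).

Definition ff_init (c : 'I_N -> R) (v : 'I_N -> d.+1.-tuple R) :
    'rV[R]_(N + (N * d + N)) :=
  row_mx (\row_i c i)
    (row_mx
      (mxvec (\matrix_(i < N, l < d) tnth (v i) (widen_ord (leqnSn d) l)))
      (\row_i tnth (v i) ord_max)).

Definition kron_init (K : nat) (c : 'I_N -> R) (v : 'I_N -> d.+1.-tuple R) :
    'rV[R]_(N + (N * d + N) + (K + K)) :=
  row_mx (ff_init c v)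
    (row_mx (\row_(k < K) (k == 0 :> nat)%:R) (const_mx 1)).

End networks.

Definition square_loss {R : realType} (n d m : nat)
    (u : 'rV[R]_n -> 'cV[R]_d -> R) (x : 'I_m -> 'cV[R]_d) (y : 'I_m -> R)
    (th : 'rV[R]_n) : R :=
  2^-1 * \sum_(j < m) (u th (x j) - y j) ^+ 2.

Definition gradient {R : realType} (n : nat) (L : 'rV[R]_n -> R)
    (th : 'rV[R]_n) : 'rV[R]_n :=
  \row_i 'D_(delta_mx 0 i) L th.

(* The derivative in time is taken within [0, +oo[, so it is the right
   derivative at t = 0 and the two-sided one for t > 0; the values of theta at
   negative times are irrelevant. *)
Definition gradient_flow {R : realType} (n : nat) (L : 'rV[R]_n -> R)
    (theta : R -> 'rV[R]_n) : Prop :=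
  forall t : R, 0 <= t ->
    (s - t)^-1 *: (theta s - theta t) @[s --> within `[0, +oo[ t^'] -->
      - gradient L (theta t).

Definition C1 {R : realType} (f : R -> R) : Prop :=
  (forall z, derivable f z 1) /\ continuous (derive1 f).

Definition full_rank {R : realType} (p q : nat) (A : 'M[R]_(p, q)) : Prop :=
  \rank A = minn p q.

Definition continuous_law {R : realType} (mu : set R -> \bar R) : Prop :=
  forall z : R, mu [set z] = 0%E.

Definition symmetric_law {R : realType} (mu : set R -> \bar R) : Prop :=
  forall A : set R, measurable A -> mu (-%R @^-1` A) = mu A.

(* N(0, I_n) on R^n, given by its values on the measurable boxes. *)
Definition std_normal_law {R : realType} (n : nat)
    (mu : set (n.-tuple R) -> \bar R) : Prop :=
  forall A : 'I_n -> set R, (forall l, measurable (A l)) ->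
    mu [set z | forall l, A l (tnth z l)] =
      (\prod_(l < n) fine (normal_prob 0 1 (A l)))%:E.

Definition mutually_independent d (T : measurableType d) (R : realType)
    (P : probability T R) (I : finType) (F : I -> set (set T)) : Prop :=
  forall (J : {set I}) (A : I -> set T), (forall i, F i (A i)) ->
    P (\bigcap_(i in [set` J]) A i) = (\prod_(i in J) fine (P (A i)))%:E.

Definition generated_sigma d d' (T : measurableType d) (T' : measurableType d')
    (X : T -> T') : set (set T) :=
  preimage_set_system setT X measurable.

(* Excludes the degenerate data for which both losses are constant with
   positive probability.  If at every input the labels add up to 0 and phi1
   vanishes on a set of positive measure, then with positive probability
   phi1 (w_i^T x_j + b_i) = 0 for all i and j, and the initialization is then a
   stationary point of both gradient flows. *)
Definition nondegenerate_data {R : realType} (d m : nat) (phi1 : R -> R)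
    (x : 'I_m -> 'cV[R]_d) (y : 'I_m -> R) : Prop :=
  (exists j, \sum_(l < m | x l == x j) y l != 0) \/
  lebesgue_measure [set z | phi1 z = 0] = 0%E.

(* Main.v *)
(* Along a gradient flow the loss has right derivative -|grad L|^2 at time 0.  At the
   given initialization the Kronecker gradient extends the feed-forward gradient by
   its alpha and omega components, so it suffices that almost surely some partial
   derivative dL/dalpha_k = sum_j r_j sum_i c_i phi_k(z_ij) is nonzero, where r is the
   vector of residuals and z_ij = w_i^T x_j + b_i.

   Fix one neuron i.  As a function of c_i this partial derivative is a polynomial of
   degree at most 2 whose coefficients are independent of c_i; the law of c_i has no
   atoms, so almost surely c_i is not a root unless the polynomial is constant.  The
   quadratic coefficient for k = 1 is sum_j phi_1(z_ij)^2.  If it vanishes, the linear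
   coefficients are sum_j r_j phi_k(z_ij), and by the rank hypothesis they vanish for
   all k only if the residuals add up to 0 over each class of equal inputs, because
   distinct inputs almost surely give distinct nodes z_ij.  By the same argument with
   an affine function of c_i, a class whose labels do not add up to 0 almost surely
   has a nonzero sum of residuals. *)
Require Import Defs.
From HB Require Import structures.
From mathcomp Require Import all_boot all_order all_algebra.
From mathcomp Require Import all_classical all_reals all_analysis.
From mathcomp Require Import measurable_realfun ring lra.
Set Implicit Arguments.
Unset Strict Implicit.
Unset Printing Implicit Defensive.
Import Order.TTheory GRing.Theory Num.Theory.
Import numFieldNormedType.Exports.
Local Open Scope classical_set_scope.
Local Open Scope ring_scope.

(** * Null sets and independence *)

Section pi_independence.
Context {R : realType} {disp : measure_display} {T : measurableType disp}.
Variables (P : probability T R) (G : set (set T)).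
Hypotheses (G_measurable : G `<=` measurable) (GI : setI_closed G) (GT : G setT).

Lemma g_sigma_measurable (B : set T) : <<s G >> B -> measurable B.
Proof. by move/(smallest_sub (@sigma_algebra_measurable _ T) G_measurable). Qed.

Let inj_meas : measurable_fun setT (idfun : T -> g_sigma_algebraType G).
Proof. by move=> _ B mB; rewrite setTI; exact: g_sigma_measurable. Qed.

(** As finite measures in [B], both sides agree on the pi-system [G], which contains the whole
    space, hence on the sigma-algebra it generates. *)
Lemma indep_g_sigma (E B : set T) : measurable E ->
  (forall B, G B -> P (B `&` E) = (P B * P E)%E) ->
  <<s G >> B -> P (B `&` E) = (P B * P E)%E.
Proof.
move=> mE PG GB.
pose r : {nonneg R} := NngNum (fine_ge0 (measure_ge0 P E)).
have rE : r%:num%:E = P E by rewrite /= fineK ?fin_num_measure.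
rewrite [RHS]muleC -rE.
apply: (@g_sigma_algebra_measure_unique _ _ _ G G_measurable (fun=> setT)
  _ _ (mrestr P mE) (mscale r P)) => //.
- by rewrite bigcup_const.
- by move=> A GA; rewrite /= /mrestr /mscale PG// rE muleC.
- by move=> _; rewrite (le_lt_trans (probability_le1 _ _)) ?ltry//=; exact: measurableI.
Qed.

(** By independence the joint law of the sample point, seen only through [<<s G >>], and of [X] is
    the product of [P] and [mu]; by Fubini the mass of [W] is the integral of the masses of its
    sections. *)
Lemma pi_indep_null (X : {RV P >-> R}) (mu : probability (measurableTypeR R) R)
    (W : set (g_sigma_algebraType G * measurableTypeR R)) :
  (forall A B, measurable A -> G B -> P (B `&` X @^-1` A) = (P B * mu A)%E) ->
  measurable W -> (forall w, mu (xsection W w) = 0%E) ->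
  P.-negligible [set w | W (w, X w)].
Proof.
move=> indep mW W0.
have mX := measurable_funPT X.
have muE A : measurable A -> P (X @^-1` A) = mu A.
  by move=> mA; rewrite -[LHS](congr1 P (setTI _)) indep// probability_setT mul1e.
pose i : T -> g_sigma_algebraType G := idfun.
pose f (w : T) := (i w, X w : measurableTypeR R).
have mf : measurable_fun setT f by exact: measurable_fun_pair.
pose iM : {mfun T >-> g_sigma_algebraType G} :=
  HB.pack i (isMeasurableFun.Build _ _ _ _ i inj_meas).
pose fM : {mfun T >-> (g_sigma_algebraType G * measurableTypeR R)%type} :=
  HB.pack f (isMeasurableFun.Build _ _ _ _ f mf).
apply/negligibleP.
  by rewrite -[X in measurable X]setTI; exact: (mf measurableT).
rewrite -[LHS]/(distribution P fM W) -(@product_measure_unique _ _ _ _ _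
  (distribution P iM) mu (distribution P fM))//.
- by rewrite /product_measure1; apply: integral0_eq => w _; exact: W0.
- move=> B A mB mA; rewrite -[LHS]/(P (B `&` X @^-1` A)) -[X in (X * _)%E]/(P B).
  transitivity (P B * P (X @^-1` A))%E; last by congr (_ * _)%E; exact: muE.
  apply: indep_g_sigma => //.
    by rewrite -[X @^-1` A]setTI; exact: mX.
  by move=> C GC; rewrite indep// muE.
Qed.

End pi_independence.

Lemma finite_measurable {R : realType} (A : set (measurableTypeR R)) :
  finite_set A -> measurable A.
Proof. by move=> /finite_set_countable; apply: countable_measurable. Qed.

Lemma finite_null {R : realType} (mu : probability (measurableTypeR R) R) (s : seq R) :
  continuous_law mu -> mu [set` s] = 0%E.
Proof.
move=> mu0; elim: s => [|a s IH].
  by rewrite (_ : [set` _] = set0) ?measure0//; apply/seteqP; split.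
have -> : [set` a :: s] = [set a] `|` [set` s].
  by apply/seteqP; split => z /=; rewrite inE => /predU1P.
apply/eqP; rewrite eq_le measure_ge0 andbT.
apply: (@le_trans _ _ (mu [set a] + mu [set` s])%E); last by rewrite mu0 IH adde0.
apply: measureU2.
- by apply: finite_measurable; exact: finite_set1.
- by apply: finite_measurable; exact: finite_seq.
Qed.

Lemma quadratic_null {R : realType} (mu : probability (measurableTypeR R) R) (a b e : R) :
  continuous_law mu -> ((a != 0) || (b != 0) || (e != 0)) ->
  mu [set t | a + b * t + e * t ^+ 2 = 0] = 0%E.
Proof.
move=> mu0 nz.
have [[t0 /= r0]|no] := pselect (exists t, a + b * t + e * t ^+ 2 = 0); last first.
  rewrite (_ : [set t | _] = set0) ?measure0//.
  by apply/seteqP; split => t //= ht; apply: no; exists t.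
(* The second point is the other root, by Vieta. If [e] is 0 it is a junk value, but then a root
   different from [t0] would force all coefficients to vanish. *)
have sub : [set t | a + b * t + e * t ^+ 2 = 0] `<=`
    [set` [:: t0; - (e * t0 + b) / e]].
  move=> t /= rt; rewrite !inE.
  have : (t - t0) * (e * t + (e * t0 + b)) = 0.
    by rewrite -[RHS](subrr 0) -{1}rt -r0; ring.
  move/eqP; rewrite mulf_eq0 subr_eq0 => /orP[->//|h].
  have [e0|e0] := eqVneq e 0.
    exfalso; move: h nz; rewrite e0 !mul0r !add0r => /eqP b0.
    by move: r0; rewrite e0 b0 !mul0r !addr0 => ->; rewrite !eqxx.
  apply/orP; right; rewrite -(inj_eq (mulfI e0)) mulrCA mulfV// mulr1.
  by rewrite -addr_eq0.
apply: (@subset_measure0 _ _ _ mu _ [set` [:: t0; - (e * t0 + b) / e]]) => //.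
- by apply: finite_measurable; apply: sub_finite_set sub _; exact: finite_seq.
- by apply: finite_measurable; exact: finite_seq.
- exact: finite_null.
Qed.

(* A pi-system generating the join of the [F s] for [s != s0]. *)
Definition others_system {T : Type} {I : finType} (F : I -> set (set T)) (s0 : I) :
    set (set T) :=
  [set B | exists2 A : I -> set T, (forall s, F s (A s)) &
     B = \bigcap_(s in [set s | s != s0]) A s].

Section others_system.
Context {R : realType} {disp : measure_display} {T : measurableType disp}.
Context {I : finType} (P : probability T R) (F : I -> set (set T)) (s0 : I).
Hypothesis F_measurable : forall s, F s `<=` measurable.
Hypothesis FI : forall s, setI_closed (F s).
Hypothesis FT : forall s, F s setT.

Lemma others_measurable : others_system F s0 `<=` measurable.
Proof.
move=> _ [A FA ->]; apply: fin_bigcap_measurable; first exact: finite_finset.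
by move=> s _; exact: F_measurable (FA s).
Qed.

Lemma others_setI : setI_closed (others_system F s0).
Proof.
move=> _ _ [A FA ->] [B FB ->]; exists (fun s => A s `&` B s).
  by move=> s; exact: FI.
by rewrite bigcapI.
Qed.

Lemma others_setT : others_system F s0 setT.
Proof. by exists (fun=> setT) => //; rewrite bigcapT. Qed.

Lemma sub_others (s : I) : s != s0 -> F s `<=` <<s others_system F s0 >>.
Proof.
move=> ss0 A FA; apply: sub_sigma_algebra.
exists (fun s' => if s' == s then A else setT).
  by move=> s'; case: eqP => [->|].
apply/seteqP; split=> [w Aw s' _|w /(_ s)]; first by case: ifP.
by rewrite eqxx; apply.
Qed.

Lemma measurable_fun_others (s : I) d' (T' : measurableType d') (Y : T -> T') :
  s != s0 -> generated_sigma Y `<=` F s ->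
  measurable_fun setT (Y : g_sigma_algebraType (others_system F s0) -> T').
Proof.
move=> ss0 YF _ B mB; have := sub_others ss0 (YF (Y @^-1` B) _).
by rewrite setTI; apply; exists B; rewrite ?setTI.
Qed.

Lemma others_indep (B E : set T) : mutually_independent P F ->
  others_system F s0 B -> F s0 E -> P (B `&` E) = (P B * P E)%E.
Proof.
move=> indep [A FA ->] FE.
(* Putting [E] in the slot [s0] left free by [B] gives an intersection over all indices;
   independence is then used once for all of [I] and once for the complement of [s0]. *)
pose A' s := if s == s0 then E else A s.
have FA' s : F s (A' s) by rewrite /A'; case: eqP => [->|].
have -> : \bigcap_(s in [set s | s != s0]) A s `&` E =
    \bigcap_(s in [set` [set: I]%SET]) A' s.
  apply/seteqP; split => [w [Aw Ew] s _|w Aw].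
    by rewrite /A'; case: eqP => // /eqP ss0; exact: Aw.
  split; last by have := Aw s0; rewrite /A' eqxx; apply; rewrite /= finset.in_setT.
  move=> s /= ss0; have := Aw s; rewrite /A' (negbTE ss0); apply.
  by rewrite /= finset.in_setT.
have -> : [set s | s != s0] = [set` [set~ s0]%SET].
  by apply/seteqP; split=> s /=; rewrite finset.in_setC1.
rewrite !indep// (bigD1 s0) ?finset.in_setT//= EFinM muleC; congr (_ * _)%E.
  congr (_%:E); apply: eq_big => s; first by rewrite finset.in_setT finset.in_setC1.
  by rewrite /A' => /andP[_ /negbTE ->].
by rewrite /A' eqxx fineK// fin_num_measure//; exact: F_measurable FE.
Qed.

(** With all sources other than [s0] frozen, [X] still has law [mu], so an event that is null in
    every such section is null. *)
Lemma indep_null (X : {RV P >-> R}) (mu : probability (measurableTypeR R) R)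
    (W : set (g_sigma_algebraType (others_system F s0) * measurableTypeR R)) :
  mutually_independent P F -> generated_sigma X `<=` F s0 ->
  (forall A, measurable A -> P (X @^-1` A) = mu A) ->
  measurable W -> (forall w, mu (xsection W w) = 0%E) ->
  P.-negligible [set w | W (w, X w)].
Proof.
move=> indep XF Xmu; apply: pi_indep_null.
- exact: others_measurable.
- exact: others_setI.
- exact: others_setT.
- move=> A B mA GB; rewrite -Xmu//; apply: others_indep => //.
  by apply: XF; exists A => //; rewrite setTI.
Qed.

End others_system.

Section generated_sigma.
Context {d d' : measure_display} {T : measurableType d} {T' : measurableType d'}.
Variable Y : T -> T'.

Lemma generated_sigma_measurable : measurable_fun setT Y -> generated_sigma Y `<=` measurable.
Proof. by move=> mY _ [B mB <-]; exact: mY. Qed.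

Lemma generated_sigma_setI : setI_closed (generated_sigma Y).
Proof.
move=> _ _ [A mA <-] [B mB <-]; exists (A `&` B); first exact: measurableI.
by rewrite !setTI.
Qed.

Lemma generated_sigma_setT : generated_sigma Y setT.
Proof. by exists setT => //; rewrite setTI preimage_setT. Qed.

End generated_sigma.

(** * Standard normal vectors *)

(** Translation preserves the length of half-open intervals, and these determine Lebesgue
    measure. *)
Lemma lebesgue_measure_translate {R : realType} (s : R) (A : set R) :
  measurable A -> lebesgue_measure ((fun t : R => t + s) @^-1` A) = lebesgue_measure A.
Proof.
move=> mA; pose f : measurableTypeR R -> measurableTypeR R := fun t : R => t + s.
have mf : measurable_fun setT f by exact: measurable_funD.
pose fM : {mfun measurableTypeR R >-> measurableTypeR R} :=
  HB.pack f (isMeasurableFun.Build _ _ _ _ f mf).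
apply/esym/(@lebesgue_measure_unique _ (pushforward lebesgue_measure fM)) => //= _ [[a b]] _ <-.
rewrite /pushforward (_ : _ @^-1` _ = `](a - s), (b - s)]%classic).
  rewrite !lebesgue_measure_itv/= !lte_fin ltrD2r; case: ifP => // _.
  by rewrite -!EFinB; congr (_%:E); ring.
by apply/seteqP; split=> t; rewrite /= /f !in_itv/= ltrBlDr lerBrDr.
Qed.

Section normal_vector.
Context {R : realType} {disp : measure_display} {T : measurableType disp}.
Context (n : nat) (P : probability T R) (Y : {RV P >-> n.-tuple R}).
Hypothesis Y_law : std_normal_law (distribution P Y).

Definition tuple_coord (l : 'I_n) (w : T) : R := tnth (Y w) l.

Lemma measurable_tuple_coord l : measurable_fun setT (tuple_coord l).
Proof. exact: measurableT_comp (measurable_tnth l) (measurable_funPT Y). Qed.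

HB.instance Definition _ l :=
  isMeasurableFun.Build _ _ _ _ (tuple_coord l) (measurable_tuple_coord l).

Lemma tuple_coord_box (J : {set 'I_n}) (B : 'I_n -> set R) :
  (forall l, measurable (B l)) ->
  P (\bigcap_(l in [set` J]) (tuple_coord l @^-1` B l)) =
    (\prod_(l in J) fine (normal_prob 0 1 (B l)))%:E.
Proof.
(* Coordinates outside [J] are left free; each contributes the total mass 1. *)
move=> mB; pose B' l := if l \in J then B l else setT.
have mB' l : measurable (B' l) by rewrite /B'; case: ifP.
transitivity (distribution P Y [set z | forall l, B' l (tnth z l)]).
  congr (P _); apply/seteqP; split => w /=.
    by move=> Bw l; rewrite /B'; case: ifP => // /Bw.
  by move=> Bw l /= lJ; have := Bw l; rewrite /B' lJ.
rewrite Y_law//; congr (_%:E); rewrite [RHS]big_mkcond; apply: eq_bigr => l _.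
by rewrite /B'; case: ifP => // _; rewrite probability_setT.
Qed.

Lemma tuple_coord_law (l : 'I_n) (B : set R) : measurable B ->
  P (tuple_coord l @^-1` B) = normal_prob 0 1 B.
Proof.
move=> mB; have := @tuple_coord_box [set l]%SET (fun=> B) (fun=> mB).
rewrite big_set1 fineK ?fin_num_measure// => <-; congr (P _).
apply/seteqP; split => w /=; first by move=> Bw l'; rewrite /= finset.in_set1 => /eqP ->.
by apply; rewrite /= finset.in_set1.
Qed.

Lemma tuple_coord_indep : mutually_independent P (fun l => generated_sigma (tuple_coord l)).
Proof.
move=> J A FA.
have /choice[B BE] : forall l, exists B : set R, measurable B /\ A l = tuple_coord l @^-1` B.
  by move=> l; have [B mB <-] := FA l; exists B; rewrite setTI.
have -> : \bigcap_(l in [set` J]) A l = \bigcap_(l in [set` J]) (tuple_coord l @^-1` B l).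
  by apply: eq_bigcapr => l _; exact: (BE l).2.
rewrite tuple_coord_box; last by move=> l; exact: (BE l).1.
congr (_%:E); apply: eq_bigr => l _.
by rewrite (BE l).2 tuple_coord_law//; exact: (BE l).1.
Qed.

(** Given the other coordinates, the sum is coordinate [l0] plus a constant. As [a l0 = 1], each
    section is a translate of [B], still Lebesgue null, and the normal law is absolutely
    continuous. *)
Lemma normal_affine_null (a : 'I_n -> R) (l0 : 'I_n) (B : set R) :
  a l0 = 1 -> measurable B -> lebesgue_measure B = 0%E ->
  P.-negligible [set w | B (\sum_l a l * tuple_coord l w)].
Proof.
move=> a1 mB B0.
pose F l := generated_sigma (tuple_coord l).
pose U := g_sigma_algebraType (others_system F l0).
pose g (w : U) : R := \sum_(l | l != l0) a l * tuple_coord l w.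
pose W : set (U * measurableTypeR R) := [set p | B (p.2 + g p.1)].
have -> : [set w | B (\sum_l a l * tuple_coord l w)] = [set w | W (w, tuple_coord l0 w)].
  by apply/funext => w; rewrite /W/= /g (bigD1 l0)//= a1 mul1r.
apply: (@indep_null _ _ _ _ P F l0 _ _ _ (tuple_coord l0) (normal_prob 0 1) W).
- by move=> l; apply: generated_sigma_measurable; exact: measurable_tuple_coord.
- by move=> l; exact: generated_sigma_setI.
- by move=> l; exact: generated_sigma_setT.
- exact: tuple_coord_indep.
- by [].
- by move=> A mA; exact: tuple_coord_law.
- have mg : measurable_fun setT g.
    rewrite (_ : g = fun w => \sum_l (if l != l0 then a l * tuple_coord l w else 0)); last first.
      by apply/funext => w; rewrite /g big_mkcond.
    apply: measurable_sum => l; case: (boolP (l != l0)) => [ll0|_]; last exact: measurable_cst.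
    apply: measurable_funM; first exact: measurable_cst.
    apply: (@measurable_fun_others _ _ _ F l0 _ l) => // s; exact: generated_sigma_setT.
  have mD : measurable_fun setT (fun p : U * measurableTypeR R => p.2 + g p.1).
    by apply: measurable_funD => //; exact: measurableT_comp.
  by rewrite -[W]setTI; exact: mD.
- move=> w.
  have -> : xsection W w = (fun t => t + g w) @^-1` B.
    by apply/seteqP; split=> t; rewrite /xsection /= in_setE.
  have /null_content_dominatesP := normal_prob_dominates 0 (1 : R); apply.
    by rewrite -[_ @^-1` _]setTI; apply: measurable_funD.
  by rewrite -[RHS]B0; exact: lebesgue_measure_translate.
Qed.

End normal_vector.

(** * The derivative with respect to alpha *)

Section class_sums.
Context {R : realType} {m : nat}.

(* Repeated nodes are separated by moving all but the first copy of each to fresh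
   points, at the price of concentrating the weights on the first copies. *)
Lemma full_rank_class_sum (K : nat) (phi : 'I_K -> R -> R) (z s : 'I_m -> R) :
  (m <= K)%N ->
  (forall z : 'I_m -> R, injective z -> full_rank (\matrix_(k < K, j < m) phi k (z j))) ->
  (forall k, \sum_j s j * phi k (z j) = 0) ->
  forall j, \sum_(l | z l == z j) s l = 0.
Proof.
move=> mK rk sum0 j.
(* The first index with the same node as [i]; since [i] itself qualifies, the default is never
   returned. *)
pose rep i := odflt i [pick l | z l == z i].
have zrep i : z (rep i) = z i by rewrite /rep; case: pickP => //= l /eqP.
have eq_rep i i' : z i = z i' -> rep i = rep i'.
  by move=> zii'; rewrite /rep zii'; case: pickP => // /(_ i'); rewrite eqxx.
have repP i i' : rep i = i -> (z i' == z i) = (rep i' == i).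
  move=> repi; apply/eqP/eqP => [/eq_rep -> //|<-]; by rewrite zrep.
(* A bound above every node, so that the points [M + i] are fresh and pairwise distinct. *)
pose M := 1 + \sum_l `|z l|.
have zM i : z i < M.
  rewrite (le_lt_trans (ler_norm _))// /M (bigD1 i)//= addrCA ltrDl.
  by rewrite ltr_pwDl// sumr_ge0.
pose z' i := if rep i == i then z i else M + (i : nat)%:R.
have z'_inj : injective z'.
  have ne i i' : z i = M + i'%:R -> False.
    by move=> h; have := zM i; rewrite h ltNge lerDl ler0n.
  move=> i i'; rewrite /z'; case: eqP => [ri|_]; case: eqP => [ri'|_].
  - by move=> /eq_rep; rewrite ri ri'.
  - by move=> /ne.
  - by move=> /esym/ne.
  - by move=> /addrI/eqP; rewrite eqr_nat => /eqP/val_inj.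
pose s' := \row_i (if rep i == i then \sum_(l | z l == z i) s l else 0).
pose A := \matrix_(k < K, i < m) phi k (z' i).
have s'A : s' *m A^T = 0.
  apply/rowP => k; rewrite !mxE -[RHS](sum0 k).
  rewrite [RHS](partition_big rep (fun i => rep i == i))/=; last first.
    by move=> i _; apply/eqP; apply: eq_rep; exact: zrep.
  rewrite [RHS]big_mkcond; apply: eq_bigr => i _; rewrite !mxE /z'.
  case: eqP => [ri|_]; last by rewrite mul0r.
  rewrite mulr_suml; apply: eq_big => l; first exact: repP.
  by move=> /eqP ->.
(* As [m <= K], full rank means rank [m]: the rows of the transpose are independent, which forces
   [s' = 0]. *)
have : row_free A^T.
  by rewrite /row_free mxrank_tr (rk _ z'_inj) (minn_idPr mK).
move=> /(mulmx_free_eq0 s'); rewrite s'A eqxx => /esym/eqP/rowP/(_ (rep j)).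
rewrite !mxE zrep ifT//; apply/eqP; apply: eq_rep; exact: zrep.
Qed.

End class_sums.

(** * Random polynomials in one output weight *)

Section random_gradient.
Context {R : realType} {disp : measure_display} {T : measurableType disp}.
Context {n N : nat} (P : probability T R) (mu : probability (measurableTypeR R) R).
Variables (c : 'I_N -> {RV P >-> R}) (v : 'I_N -> {RV P >-> n.-tuple R}).
Hypothesis mu_cont : continuous_law mu.
Hypothesis c_law : forall (i : 'I_N) (A : set R), measurable A ->
  distribution P (c i) A = mu A.

Definition init_sigma (s : 'I_N + 'I_N) : set (set T) :=
  match s with
  | inl i => generated_sigma (c i)
  | inr i => generated_sigma (v i)
  end.

Hypothesis cv_indep : mutually_independent P init_sigma.

Let F_measurable s : init_sigma s `<=` measurable.
Proof. by case: s => i; exact/generated_sigma_measurable/measurable_funPT. Qed.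

Let FI s : setI_closed (init_sigma s).
Proof. by case: s => i; exact: generated_sigma_setI. Qed.

Let FT s : init_sigma s setT.
Proof. by case: s => i; exact: generated_sigma_setT. Qed.

(** The sample space carrying only the information of the sources other than [c i]: under
    [cv_indep], functions measurable on it are independent of [c i]. *)
Definition others_type (i : 'I_N) := g_sigma_algebraType (others_system init_sigma (inl i)).

Lemma others_measurable_c (i i' : 'I_N) : i' != i ->
  measurable_fun setT (c i' : others_type i -> R).
Proof.
by move=> ii'; apply: (@measurable_fun_others _ _ _ init_sigma (inl i) FT (inl i')).
Qed.

Lemma others_measurable_v (i i' : 'I_N) (l : 'I_n) :
  measurable_fun setT (tuple_coord (v i') l : others_type i -> R).
Proof.
apply: measurableT_comp (measurable_tnth l) _.
exact: (@measurable_fun_others _ _ _ init_sigma (inl i) FT (inr i')).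
Qed.

(** The coefficients are independent of the atomless [c i], so they can be frozen, and a nonconstant
    polynomial has finitely many roots. The guard on [b] and [e] excludes constant polynomials,
    which may vanish identically. *)
Lemma quadratic_root_null (i : 'I_N) (a b e : others_type i -> R) :
  measurable_fun setT a -> measurable_fun setT b -> measurable_fun setT e ->
  P.-negligible [set w |
    ((b w != 0) || (e w != 0)) /\ a w + b w * c i w + e w * c i w ^+ 2 = 0].
Proof.
move=> ma mb me.
pose f (p : others_type i * measurableTypeR R) : R :=
  a p.1 + b p.1 * p.2 + e p.1 * p.2 ^+ 2.
have m0 (h : others_type i * measurableTypeR R -> R) :
    measurable_fun setT h -> measurable [set p | h p = 0].
  by move=> mh; rewrite -[[set _ | _]]setTI; exact: (mh measurableT [set 0]).
have m1 (h : others_type i -> R) : measurable_fun setT h ->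
    measurable_fun setT (fun p : others_type i * measurableTypeR R => h p.1).
  by move=> mh; exact: measurableT_comp.
pose W : set (others_type i * measurableTypeR R) :=
  [set p | f p = 0] `\` ([set p | b p.1 = 0] `&` [set p | e p.1 = 0]).
have -> : [set w | ((b w != 0) || (e w != 0)) /\
    a w + b w * c i w + e w * c i w ^+ 2 = 0] = [set w | W (w, c i w)].
  apply/seteqP; split => w [] /= h1 h2; split => //=.
    by move=> [b0 e0]; move: h1; rewrite b0 e0 !eqxx.
  by rewrite -negb_and; apply/negP => /andP[/eqP ? /eqP ?]; exact: h2.
apply: (@indep_null _ _ _ _ P init_sigma (inl i) _ _ _ (c i) mu W) => //.
- by move=> A mA; exact: c_law.
- apply: measurableD; last first.
    by apply: measurableI; [apply: (m0 (fun p => b p.1))|apply: (m0 (fun p => e p.1))]; exact: m1.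
  apply: m0; apply: measurable_funD; first apply: measurable_funD; first exact: m1.
  + by apply: measurable_funM; [exact: m1|exact: measurable_snd].
  + by apply: measurable_funM; [exact: m1|apply: measurable_funX; exact: measurable_snd].
- move=> w.
  have [be0|be0] := boolP ((b w != 0) || (e w != 0)).
    have -> : xsection W w = [set t | a w + b w * t + e w * t ^+ 2 = 0].
      apply/seteqP; split=> t; rewrite /xsection /= in_setE; first by case.
      by move=> h; split => // -[/= b0 e0]; move: be0; rewrite b0 e0 eqxx.
    by apply: quadratic_null => //; rewrite -orbA be0 orbT.
  rewrite (_ : xsection W w = set0) ?measure0//.
  apply/seteqP; split=> t //; rewrite /xsection /= in_setE => -[_ /= h].
  by move: be0; rewrite -negb_and negbK => /andP[/eqP ? /eqP ?]; exact: h.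
Qed.

End random_gradient.

Section augmented_inputs.
Context {R : realType} {d : nat}.

(** Appending 1 to the input absorbs the bias, so that a preactivation is the inner product with
    [v i]. *)
Definition augmented (x : 'cV[R]_d) (l : 'I_d.+1) : R :=
  if unlift ord_max l is Some l' then x l' 0 else 1.

Lemma augmented_ord_max x : augmented x ord_max = 1.
Proof. by rewrite /augmented unlift_none. Qed.

Lemma augmented_widen x (l : 'I_d) : augmented x (widen_ord (leqnSn d) l) = x l 0.
Proof.
rewrite /augmented (_ : widen_ord _ l = lift ord_max l) ?liftK//.
by apply: val_inj; exact/esym/lift_max.
Qed.

End augmented_inputs.

Section alpha_gradient.
Context {R : realType} {disp : measure_display} {T : measurableType disp}.
Context {d m N K : nat} (P : probability T R) (mu : probability (measurableTypeR R) R).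
Variables (x : 'I_m -> 'cV[R]_d) (y : 'I_m -> R) (phi : 'I_K -> R -> R) (k0 : 'I_K).
Variables (c : 'I_N -> {RV P >-> R}) (v : 'I_N -> {RV P >-> d.+1.-tuple R}).
Hypothesis mu_cont : continuous_law mu.
Hypothesis c_law : forall (i : 'I_N) (A : set R), measurable A ->
  distribution P (c i) A = mu A.
Hypothesis v_law : forall i : 'I_N, std_normal_law (distribution P (v i)).
Hypothesis cv_indep : mutually_independent P (init_sigma c v).
Hypothesis phi_continuous : forall k, continuous (phi k).

(* The preactivation of neuron [i] at the input [x j], at initialization. *)
Definition node (i : 'I_N) (j : 'I_m) (w : T) : R :=
  \sum_l augmented (x j) l * tuple_coord (v i) l w.

Definition unit_out (k : 'I_K) (j : 'I_m) (w : T) : R :=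
  \sum_i c i w * phi k (node i j w).

Definition residual (j : 'I_m) (w : T) : R := unit_out k0 j w - y j.

(* The derivative of the loss with respect to [alpha_k] at initialization. *)
Definition alpha_grad (k : 'I_K) (w : T) : R :=
  \sum_j residual j w * unit_out k j w.

(** The difference of the two nodes is a nonzero linear form in the normal vector [v i]; dividing by
    a nonzero coefficient normalizes it for [normal_affine_null] with the null set [[set 0]]. *)
Lemma node_distinct (i : 'I_N) (j l : 'I_m) : x j != x l ->
  {ae P, forall w, node i j w != node i l w}.
Proof.
move=> xjl.
have [l0 al0] : exists l0, augmented (x j) l0 - augmented (x l) l0 != 0.
  apply: contrapT => /forallNP h; move/eqP: xjl; apply; apply/colP => l'.
  have /negP := h (widen_ord (leqnSn d) l').
  by rewrite negbK !augmented_widen subr_eq0 => /eqP.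
set e := augmented (x j) l0 - augmented (x l) l0 in al0.
pose a l' := (augmented (x j) l' - augmented (x l) l') / e.
have := @normal_affine_null _ _ _ _ P (v i) (v_law i) a l0 [set 0].
rewrite /a mulfV// => /(_ erefl (measurable_set1 _) (lebesgue_measure_set1 _)).
apply: negligibleS => w /= /negP; rewrite negbK => /eqP njl.
transitivity ((node i j w - node i l w) / e); last by rewrite njl subrr mul0r.
rewrite /node -sumrB mulr_suml; apply: eq_bigr => l' _; ring.
Qed.

(** The bias enters the node with coefficient 1, so [normal_affine_null] applies to the zero set of
    [phi k0]. *)
Lemma node_avoids_zeros (i : 'I_N) (j : 'I_m) :
  lebesgue_measure [set z | phi k0 z = 0] = 0%E ->
  {ae P, forall w, phi k0 (node i j w) != 0}.
Proof.
move=> phi0.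
have mphi0 : measurable [set z | phi k0 z = 0].
  have := continuous_measurable_fun (@phi_continuous k0) measurableT (measurable_set1 0).
  by rewrite setTI.
have := normal_affine_null (v_law i) (augmented_ord_max (x j)) mphi0 phi0.
by apply: negligibleS => w /= /negP; rewrite negbK => /eqP.
Qed.

Section split.
Variable i : 'I_N.

Definition unit_rest (k : 'I_K) (j : 'I_m) (w : T) : R :=
  \sum_(i' | i' != i) c i' w * phi k (node i' j w).

Lemma unit_outE k j w : unit_out k j w = unit_rest k j w + phi k (node i j w) * c i w.
Proof. by rewrite /unit_out (bigD1 i)//= addrC [in RHS]mulrC. Qed.

Let U := others_type c v i.

Lemma measurable_phi_node k i' j : measurable_fun setT (fun w : U => phi k (node i' j w)).
Proof.
apply: measurableT_comp; first exact: continuous_measurable_fun.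
apply: measurable_sum => l; apply: measurable_funM; first exact: measurable_cst.
exact: others_measurable_v.
Qed.

Lemma measurable_unit_rest k j : measurable_fun setT (unit_rest k j : U -> R).
Proof.
rewrite (_ : unit_rest k j =
    fun w => \sum_i' if i' != i then c i' w * phi k (node i' j w) else 0); last first.
  by apply/funext => w; rewrite /unit_rest big_mkcond.
apply: measurable_sum => i'; case: (boolP (i' != i)) => [ii'|_]; last exact: measurable_cst.
by apply: measurable_funM; [exact: others_measurable_c|exact: measurable_phi_node].
Qed.

(** The residual and [unit_out] are both affine in [c i], so [alpha_grad k] is quadratic in [c i];
    these are its coefficients, none of which involves [c i]. *)
Definition alpha_grad_coef0 k w :=
  \sum_j (unit_rest k0 j w - y j) * unit_rest k j w.
Definition alpha_grad_coef1 k w :=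
  \sum_j ((unit_rest k0 j w - y j) * phi k (node i j w) +
          phi k0 (node i j w) * unit_rest k j w).
Definition alpha_grad_coef2 k w :=
  \sum_j phi k0 (node i j w) * phi k (node i j w).

Lemma alpha_gradE k w : alpha_grad k w =
  alpha_grad_coef0 k w + alpha_grad_coef1 k w * c i w + alpha_grad_coef2 k w * c i w ^+ 2.
Proof.
rewrite /alpha_grad /alpha_grad_coef0 /alpha_grad_coef1 /alpha_grad_coef2.
rewrite !mulr_suml -!big_split; apply: eq_bigr => j _ /=.
by rewrite /residual !unit_outE; ring.
Qed.

Lemma alpha_grad_neq0 k :
  {ae P, forall w, (alpha_grad_coef1 k w != 0) || (alpha_grad_coef2 k w != 0) ->
    alpha_grad k w != 0}.
Proof.
have mr j : measurable_fun setT (fun w : U => unit_rest k0 j w - y j).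
  by apply: measurable_funB; [exact: measurable_unit_rest|exact: measurable_cst].
have mq k' : measurable_fun setT (alpha_grad_coef1 k' : U -> R).
  apply: measurable_sum => j; apply: measurable_funD; apply: measurable_funM => //;
    by [exact: measurable_phi_node|exact: measurable_unit_rest].
apply: negligibleS (quadratic_root_null mu_cont c_law cv_indep (i := i)
  (a := alpha_grad_coef0 k) (b := alpha_grad_coef1 k) (e := alpha_grad_coef2 k) _ _ _) => //.
- move=> w /= /not_implyP[h /negP]; rewrite negbK alpha_gradE => /eqP; by split.
- by apply: measurable_sum => j; apply: measurable_funM => //; exact: measurable_unit_rest.
- by apply: measurable_sum => j; apply: measurable_funM; exact: measurable_phi_node.
Qed.

(** A class sum of residuals is affine in [c i], and the sum in the premise is its slope; this is
    [quadratic_root_null] with zero leading coefficient. *)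
Lemma class_residual_slope (j : 'I_m) :
  {ae P, forall w, \sum_(l | x l == x j) phi k0 (node i l w) != 0 ->
    \sum_(l | x l == x j) residual l w != 0}.
Proof.
pose a w := \sum_l if x l == x j then unit_rest k0 l w - y l else 0.
pose b w := \sum_l if x l == x j then phi k0 (node i l w) else 0.
apply: negligibleS (quadratic_root_null mu_cont c_law cv_indep (i := i)
  (a := a) (b := b) (e := cst 0) _ _ _) => //.
- move=> w /= /not_implyP[h /negP]; rewrite negbK => /eqP r0; split.
    by rewrite /b -big_mkcond h.
  rewrite mul0r addr0 -[RHS]r0 /a /b -!big_mkcond/= mulr_suml -big_split.
  by apply: eq_bigr => l _; rewrite /residual unit_outE/=; ring.
- apply: measurable_sum => l; case: (x l == x j); last exact: measurable_cst.
  by apply: measurable_funB; [exact: measurable_unit_rest|exact: measurable_cst].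
- apply: measurable_sum => l; case: (x l == x j); last exact: measurable_cst.
  exact: measurable_phi_node.
Qed.

End split.

Hypothesis mK : (m <= K)%N.
Hypothesis phi_rank : forall z : 'I_m -> R, injective z ->
  full_rank (\matrix_(k < K, j < m) phi k (z j)).

(** If some neuron has a nonzero slope, [class_residual_slope] applies. If all slopes vanish, the
    network outputs add up to 0 over the class and the residuals add up to minus the sum of the
    labels. *)
Lemma class_residual_neq0 (j : 'I_m) : \sum_(l | x l == x j) y l != 0 ->
  {ae P, forall w, \sum_(l | x l == x j) residual l w != 0}.
Proof.
move=> Yj.
have : {ae P, forall w, forall i, \sum_(l | x l == x j) phi k0 (node i l w) != 0 ->
    \sum_(l | x l == x j) residual l w != 0}.
  by apply: filter_forall => i; exact: class_residual_slope.
apply: filterS => w h; apply/negP => /[dup] /eqP + r0.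
rewrite /residual sumrB /unit_out exchange_big/= big1 => [|i _].
  by rewrite sub0r => /eqP; rewrite oppr_eq0 (negbTE Yj).
rewrite -mulr_sumr; have [->|/h] := eqVneq (\sum_(l | x l == x j) phi k0 (node i l w)) 0.
  by rewrite mulr0.
by rewrite r0.
Qed.

Lemma alpha_grad_ae_neq0 (i : 'I_N) (j0 : 'I_m) : nondegenerate_data (phi k0) x y ->
  {ae P, forall w, exists k, alpha_grad k w != 0}.
Proof.
move=> nd.
suff : {ae P, forall w, exists k,
    (alpha_grad_coef1 i k w != 0) || (alpha_grad_coef2 i k w != 0)}.
  have : {ae P, forall w, forall k,
      (alpha_grad_coef1 i k w != 0) || (alpha_grad_coef2 i k w != 0) ->
      alpha_grad k w != 0}.
    by apply: filter_forall => k; exact: alpha_grad_neq0.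
  by apply: filterS2 => w h [k /h ?]; exists k.
(* For [k0] the quadratic coefficient is a sum of squares. *)
have coef2 w j : phi k0 (node i j w) != 0 -> alpha_grad_coef2 i k0 w != 0.
  move=> pj; rewrite gt_eqF// /alpha_grad_coef2 (bigD1 j)//= -expr2.
  rewrite ltr_pwDl// ?exprn_even_gt0 ?pj//.
  by apply: sumr_ge0 => l _; rewrite -expr2 sqr_ge0.
(* If the zeros of [phi k0] form a null set, a single data point makes this sum of squares
   positive. *)
case: nd => [[j Yj]|phi0]; last first.
  apply: filterS (node_avoids_zeros i j0 phi0) => w /coef2 h.
  by exists k0; rewrite h orbT.
have sep : {ae P, forall w, forall l l', x l != x l' -> node i l w != node i l' w}.
  apply: filter_forall => l; apply: filter_forall => l'.
  have [e|xll'] := boolP (x l == x l').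
    exact: aeW.
  by apply: filterS (node_distinct i xll').
apply: filterS2 sep (class_residual_neq0 Yj) => w sep rj.
have [[k ?]|h] := pselect (exists k, (alpha_grad_coef1 i k w != 0) ||
    (alpha_grad_coef2 i k w != 0)); first by exists k.
have {}h k : alpha_grad_coef1 i k w = 0 /\ alpha_grad_coef2 i k w = 0.
  by split; apply: contrapT => /eqP hk; apply: h; exists k; rewrite hk ?orbT.
(* A vanishing sum of squares kills every [phi k0] at the nodes of neuron [i]; the linear
   coefficients thus reduce to the residuals summed against [phi k]. *)
have q0 l : phi k0 (node i l w) = 0.
  by apply: contrapT => /eqP/coef2; rewrite (h k0).2 eqxx.
have res l : residual l w = unit_rest i k0 l w - y l.
  by rewrite /residual (unit_outE i) q0 mul0r addr0.
have := @full_rank_class_sum _ _ _ phi (fun l => node i l w) (residual ^~ w) mK phi_rank.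
move=> /(_ _ j) cs; exfalso; move/eqP: rj; apply.
(* Equal nodes come only from equal inputs here, so the classes of nodes are the classes of
   inputs. *)
rewrite -[RHS]cs => [|k].
  apply: eq_bigl => l; apply/eqP/eqP => [xl|nl]; first by rewrite /node xl.
  by apply: contrapT => /eqP/sep; rewrite nl eqxx.
rewrite -[RHS](h k).1 /alpha_grad_coef1; apply: eq_bigr => l _.
by rewrite q0 mul0r addr0 res.
Qed.

End alpha_gradient.

(** * The loss along a gradient flow *)

Section loss_along_flow.
Context {R : realType}.

Lemma differentiable_sum_fun {V W : normedModType R} (n : nat) (f : 'I_n -> V -> W) (p : V) :
  (forall i, differentiable (f i) p) -> differentiable (fun q => \sum_i f i q) p.
Proof.
move=> df; rewrite (_ : (fun q => _) = \sum_i f i); first exact: differentiable_sum.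
by apply/funext => q; rewrite fct_sumE.
Qed.

Lemma diff_gradient (n : nat) (L : 'rV[R]_n -> R) (p D : 'rV[R]_n) :
  differentiable L p -> 'd L p D = \sum_i D 0 i * gradient L p 0 i.
Proof.
move=> dL; rewrite {1}(row_sum_delta D) linear_sum; apply: eq_bigr => i _.
by rewrite linearZ /= mxE deriveE.
Qed.

(* The flow is extended to negative times by its right tangent at 0, which turns the
   one-sided derivative into a two-sided one and makes the chain rule applicable. *)
Lemma gradient_flow_loss (n : nat) (L : 'rV[R]_n -> R) (theta : R -> 'rV[R]_n) :
  differentiable L (theta 0) -> gradient_flow L theta ->
  h^-1 * (L (theta h) - L (theta 0)) @[h --> 0^'+] -->
    - \sum_i gradient L (theta 0) 0 i ^+ 2.
Proof.
move=> dL /(_ 0 (lexx _)); set D := - gradient L (theta 0) => flow.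
pose th t := if 0 <= t then theta t else theta 0 + t *: D.
have th0 : th 0 = theta 0 by rewrite /th lexx.
have dth : h^-1 *: ((th \o shift 0) (h *: 1) - th 0) @[h --> 0^'] --> D.
  move=> A DA; have := flow A DA.
  rewrite /nbhs /= => flowA; near=> h; rewrite /= addr0 -[h *: 1]/(h * 1) mulr1 th0 /th.
  have hN0 : h != 0 by near: h; exact: nbhs_dnbhs_neq.
  case: ifPn => [h0|_].
    suff : A ((h - 0)^-1 *: (theta h - theta 0)) by rewrite subr0.
    have : `[0, +oo[%classic h by rewrite /= in_itv/= h0.
    by near: h; exact: flowA.
  (* For negative [h] the quotient is exactly [D]. *)
  rewrite [theta 0 + _]addrC addrK scalerA mulVf// scale1r; exact: nbhs_singleton.
have derth : derivable th 0 1 by apply/cvg_ex; exists D.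
have dfth : differentiable th 0 by exact/derivable1_diffP.
have dth1 : 'd th 0 1 = D by rewrite -deriveE//; exact/cvg_lim.
have dLth : differentiable L (th 0) by rewrite th0.
have dcomp := differentiable_comp dfth dLth.
have /cvg_ex[l ldef] : derivable (L \o th) 0 1 by exact/derivable1_diffP.
have lE : l = - \sum_i gradient L (theta 0) 0 i ^+ 2.
  transitivity ('D_1 (L \o th) 0); first by apply/esym/cvg_lim.
  rewrite deriveE// diff_comp//= dth1 th0 diff_gradient// -sumrN.
  by apply: eq_bigr => i _; rewrite /D mxE mulNr expr2.
rewrite -lE.
apply: cvg_trans (cvg_dnbhs_at_right ldef).
apply: near_eq_cvg; near=> h.
by rewrite /= addr0 -[h *: 1]/(h * 1) mulr1 th0 /th ifT.
Unshelve. all: by end_near. Qed.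

End loss_along_flow.

(** * Differentiability of the two losses *)

Section network_gradients.
Context {R : realType} {N d m K : nat}.
Variables (x : 'I_m -> 'cV[R]_d) (y : 'I_m -> R).

Lemma differentiable_square_loss (n : nat) (u : 'rV[R]_n -> 'cV[R]_d -> R) (p : 'rV[R]_n) :
  (forall x', differentiable (u ^~ x') p) -> differentiable (square_loss u x y) p.
Proof.
move=> du; apply: differentiableM => //.
apply: differentiable_sum_fun => j.
have dr : differentiable (fun th => u th (x j) - y j) p by exact: differentiableB.
exact: (differentiableM dr dr).
Qed.

Lemma differentiable_preactivation (i : 'I_N) (x' : 'cV[R]_d) th :
  differentiable (fun th => preactivation th i x') th.
Proof.
(* For a fixed input the preactivation is a linear form in the coordinates of the flat parameter
   vector. *)
rewrite (_ : (fun _ => _) = fun th : 'rV[R]_(N + (N * d + N)) => \sum_(l < d)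
    th 0 (rshift N (lshift N (mxvec_index i l))) * x' l 0 +
    th 0 (rshift N (rshift (N * d) i))).
  apply: differentiableD; last exact: differentiable_coord.
  apply: differentiable_sum_fun => l; apply: differentiableM => //.
  exact: differentiable_coord.
apply/funext => t; rewrite /preactivation /ff_w /ff_b !mxE; congr (_ + _).
by apply: eq_bigr => l _; rewrite !mxE.
Qed.

Lemma differentiable_ff_c (i : 'I_N) (th : 'rV[R]_(N + (N * d + N))) :
  differentiable (fun th => ff_c th 0 i) th.
Proof.
rewrite (_ : (fun _ => _) = fun th : 'rV[R]_(N + (N * d + N)) => th 0 (lshift _ i)).
  exact: differentiable_coord.
by apply/funext => t; rewrite /ff_c mxE.
Qed.

Lemma differentiable_phi (f : R -> R) (z : R) : C1 f -> differentiable f z.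
Proof. by move=> [df _]; exact/derivable1_diffP. Qed.

Lemma differentiable_ff_loss (f : R -> R) th : C1 f ->
  differentiable (square_loss (@ff_net R N d f) x y) th.
Proof.
move=> f1; apply: differentiable_square_loss => x'.
apply: differentiable_sum_fun => i; apply: differentiableM; first exact: differentiable_ff_c.
apply: (@differentiable_comp _ _ _ _ (fun th => preactivation th i x') f).
  exact: differentiable_preactivation.
exact: differentiable_phi.
Qed.

Variable phi : 'I_K -> R -> R.

Lemma differentiable_kron_loss th : (forall k, C1 (phi k)) ->
  differentiable (square_loss (@kron_net R N d K phi) x y) th.
Proof.
move=> phi1; apply: differentiable_square_loss => x'.
(* Differentiability in the feed-forward parameters lifts through the linear projection [lsubmx]. *)
have dsub (g : 'rV[R]_(N + (N * d + N)) -> R) : (forall q, differentiable g q) ->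
    differentiable (fun t : 'rV[R]_(N + (N * d + N) + (K + K)) => g (lsubmx t)) th.
  move=> dg; apply: (@differentiable_comp _ _ _ _ (fun t => lsubmx t) g) => //.
  exact: differentiable_lsubmx.
apply: differentiable_sum_fun => i; apply: differentiableM.
  by apply: (dsub (fun t => ff_c t 0 i)) => q; exact: differentiable_ff_c.
apply: differentiable_sum_fun => k; apply: differentiableM.
  rewrite (_ : (fun _ => _) =
      fun t : 'rV[R]_(N + (N * d + N) + (K + K)) => t 0 (rshift _ (lshift K k))).
    exact: differentiable_coord.
  by apply/funext => t; rewrite !mxE.
apply: (@differentiable_comp _ _ _ _ 
  (fun t : 'rV[R]_(N + (N * d + N) + (K + K)) =>
    rsubmx (rsubmx t) 0 k * preactivation (lsubmx t) i x') (phi k));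
  last exact: differentiable_phi.
apply: differentiableM.
  rewrite (_ : (fun _ => _) =
      fun t : 'rV[R]_(N + (N * d + N) + (K + K)) => t 0 (rshift _ (rshift K k))).
    exact: differentiable_coord.
  by apply/funext => t; rewrite !mxE.
by apply: (dsub (fun t => preactivation t i x')) => q; exact: differentiable_preactivation.
Qed.

End network_gradients.

(** * Comparison of the two gradients at the initialization *)

Section initial_gradient.
Context {R : realType} {N d m K : nat}.
Variables (x : 'I_m -> 'cV[R]_d) (y : 'I_m -> R) (phi : 'I_K -> R -> R).
Variables (k0 : 'I_K) (k00 : k0 = 0 :> nat).

Let nFF := (N + (N * d + N))%N.
Let L_FF := square_loss (@ff_net R N d (phi k0)) x y.
Let L_K := square_loss (@kron_net R N d K phi) x y.

(** Extends [kron_init] from [ff_init] to arbitrary feed-forward parameters, so that one can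
    differentiate along them. *)
Definition kron_point (th : 'rV[R]_nFF) : 'rV[R]_(nFF + (K + K)) :=
  row_mx th (row_mx (\row_(k < K) (k == 0 :> nat)%:R) (const_mx 1)).

(** Stated for arbitrary [al], because a partial derivative in alpha moves it off its initial
    value. *)
Lemma kron_net_alpha (th : 'rV[R]_nFF) (al : 'rV[R]_K) (x' : 'cV[R]_d) :
  kron_net phi (row_mx th (row_mx al (const_mx 1))) x' =
  \sum_k al 0 k * ff_net (phi k) th x'.
Proof.
rewrite /kron_net !row_mxKr !row_mxKl.
under [RHS]eq_bigr do rewrite mulr_sumr.
rewrite exchange_big/=; apply: eq_bigr => i _; rewrite mulr_sumr.
by apply: eq_bigr => k _; rewrite [const_mx 1 0 k]mxE mul1r mulrCA.
Qed.

Lemma kron_net_point (th : 'rV[R]_nFF) (x' : 'cV[R]_d) :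
  kron_net phi (kron_point th) x' = ff_net (phi k0) th x'.
Proof.
rewrite kron_net_alpha (bigD1 k0)//= mxE k00 eqxx mul1r big1 ?addr0// => k kk0.
rewrite mxE; case: eqP => [k0E|_]; last by rewrite mul0r.
by case/eqP: kk0; apply: val_inj; rewrite /= k0E k00.
Qed.

Lemma kron_loss_point (th : 'rV[R]_nFF) : L_K (kron_point th) = L_FF th.
Proof.
rewrite /L_K /L_FF /square_loss; congr (_ * _).
by apply: eq_bigr => j _; rewrite kron_net_point.
Qed.

(** Moving a feed-forward coordinate stays in the image of [kron_point], on which the losses agree,
    so the two difference quotients are the same function. *)
Lemma kron_gradient_ff (th : 'rV[R]_nFF) (i : 'I_nFF) :
  gradient L_K (kron_point th) 0 (lshift _ i) = gradient L_FF th 0 i.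
Proof.
rewrite !mxE /derive.
suff -> : (fun h => h^-1 *: ((L_K \o shift (kron_point th)) (h *: delta_mx 0 (lshift _ i)) -
    L_K (kron_point th))) =
  (fun h => h^-1 *: ((L_FF \o shift th) (h *: delta_mx 0 i) - L_FF th)) by [].
apply/funext => h /=; rewrite kron_loss_point; congr (_ *: (_ - _)).
rewrite -kron_loss_point; congr (L_K _).
by rewrite delta_mx_lshift scale_row_mx scaler0 add_row_mx add0r.
Qed.

(** The network is affine in alpha, so the loss is quadratic in the step [h] and its difference
    quotient is exactly [S + h * Q]. *)
Lemma kron_gradient_alpha (th : 'rV[R]_nFF) (k : 'I_K) :
  gradient L_K (kron_point th) 0 (rshift _ (lshift _ k)) =
  \sum_j (ff_net (phi k0) th (x j) - y j) * ff_net (phi k) th (x j).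
Proof.
rewrite mxE /derive; apply/cvg_lim => //.
set S := \sum_j _; pose Q := 2^-1 * \sum_j ff_net (phi k) th (x j) ^+ 2.
have : S + h * Q @[h --> (0 : R)^'] --> S.
  rewrite -[X in _ --> X]addr0 -[X in _ --> _ + X](mul0r Q).
  apply: cvgD; first exact: cvg_cst.
  apply: cvgM; last exact: cvg_cst.
  exact: nbhs_dnbhs.
apply: cvg_trans; apply: near_eq_cvg; near=> h.
have h0 : h != 0 by near: h; exact: nbhs_dnbhs_neq.
rewrite /= kron_loss_point delta_mx_rshift scale_row_mx scaler0 delta_mx_lshift.
rewrite scale_row_mx scaler0 !add_row_mx !add0r /GRing.scale/=.
have net x' : kron_net phi (row_mx th (row_mx (h *: delta_mx 0 k +
    \row_(k < K) (k == 0 :> nat)%:R) (const_mx 1))) x' =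
    ff_net (phi k0) th x' + h * ff_net (phi k) th x'.
  rewrite -kron_net_point !kron_net_alpha.
  have -> : h * ff_net (phi k) th x' =
      \sum_k' (h *: delta_mx 0 k : 'rV[R]_K) 0 k' * ff_net (phi k') th x'.
    rewrite (bigD1 k)//= !mxE !eqxx mulr1 big1 ?addr0// => k' kk'.
    by rewrite !mxE (negbTE kk') andbF mulr0 mul0r.
  rewrite -big_split/=; apply: eq_bigr => k' _; rewrite -mulrDl.
  by congr (_ * _); rewrite [LHS]mxE addrC.
rewrite /L_K /L_FF /square_loss -mulrBr -sumrB.
under [X in _ = _ * (_ * X)]eq_bigr do rewrite net.
rewrite /S /Q !mulr_sumr -big_split/=; apply: eq_bigr => j _.
by field.
Unshelve. all: by end_near. Qed.

(** The squared norm splits into blocks: the feed-forward block is common to both networks, and the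
    alpha block has a positive term. *)
Lemma kron_gradient_norm_gt (th : 'rV[R]_nFF) (k : 'I_K) :
  \sum_j (ff_net (phi k0) th (x j) - y j) * ff_net (phi k) th (x j) != 0 ->
  \sum_i gradient L_FF th 0 i ^+ 2 < \sum_i gradient L_K (kron_point th) 0 i ^+ 2.
Proof.
rewrite -kron_gradient_alpha => gk.
rewrite [ltRHS]big_split_ord/=; under [X in _ < X + _]eq_bigr do rewrite kron_gradient_ff.
rewrite ltrDl big_split_ord/= (bigD1 k)//= ltr_wpDr//.
  by apply: sumr_ge0 => i _; exact: sqr_ge0.
rewrite ltr_wpDr ?exprn_even_gt0//.
by apply: sumr_ge0 => i _; exact: sqr_ge0.
Qed.

End initial_gradient.

(* Two trajectories that start at the same loss separate at the difference of their
   squared gradient norms. *)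
Lemma steeper_flow_below {R : realType} (n n' : nat) (L : 'rV[R]_n -> R) (L' : 'rV[R]_n' -> R)
    (th : R -> 'rV[R]_n) (th' : R -> 'rV[R]_n') :
  differentiable L (th 0) -> differentiable L' (th' 0) ->
  gradient_flow L th -> gradient_flow L' th' -> L (th 0) = L' (th' 0) ->
  \sum_i gradient L (th 0) 0 i ^+ 2 < \sum_i gradient L' (th' 0) 0 i ^+ 2 ->
  exists T, 0 < T /\ forall t, 0 < t < T -> L' (th' t) < L (th t).
Proof.
move=> dL dL' fl fl' L0 lt_grad.
have lim : h^-1 * (L (th h) - L (th 0)) - h^-1 * (L' (th' h) - L' (th' 0)) @[h --> 0^'+] -->
    - (\sum_i gradient L (th 0) 0 i ^+ 2) - - (\sum_i gradient L' (th' 0) 0 i ^+ 2).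
  by apply: cvgB; exact: gradient_flow_loss.
(* The limit is positive, so the difference of the quotients is positive just to the right of 0; the
   equal initial losses then cancel. *)
have [|T /= T0 HT] := cvgr_gt _ lim 0; first by rewrite opprK addrC subr_gt0.
exists T; split => // t /andP[t0 tT].
have := HT t; rewrite /ball/= sub0r normrN gtr0_norm// => /(_ tT t0).
by rewrite -mulrBr pmulr_rgt0 ?invr_gt0// L0; lra.
Qed.

(** * The random initialization and the theorem *)

Lemma preactivation_init {R : realType} {disp : measure_display} {T : measurableType disp}
    {N d m : nat} (P : probability T R) (c : 'I_N -> {RV P >-> R})
    (v : 'I_N -> {RV P >-> d.+1.-tuple R}) (x : 'I_m -> 'cV[R]_d) i j w :
  preactivation (ff_init (c ^~ w) (v ^~ w)) i (x j) = node x v i j w.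
Proof.
rewrite /preactivation /ff_init /ff_w /ff_b !row_mxKr row_mxKl mxvecK !mxE.
rewrite /node big_ord_recr/= augmented_ord_max mul1r; congr (_ + _).
by apply: eq_bigr => l _; rewrite mxE augmented_widen mulrC.
Qed.

Lemma ff_net_init {R : realType} {disp : measure_display} {T : measurableType disp}
    {N d m K : nat} (P : probability T R) (c : 'I_N -> {RV P >-> R})
    (v : 'I_N -> {RV P >-> d.+1.-tuple R}) (x : 'I_m -> 'cV[R]_d) (phi : 'I_K -> R -> R) k j w :
  ff_net (phi k) (ff_init (c ^~ w) (v ^~ w)) (x j) = unit_out x phi c v k j w.
Proof.
apply: eq_bigr => i _; rewrite preactivation_init.
by rewrite /ff_c /ff_init row_mxKl mxE.
Qed.

Theorem theorem3p3 (R : realType) (d m N K : nat)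
  (hm : (0 < m)%N) (hN : (0 < N)%N) (hK : (0 < K)%N) (hmK : (m <= K)%N)
  (x : 'I_m -> 'cV[R]_d) (y : 'I_m -> R)
  (phi : 'I_K -> R -> R)
  (phi_C1 : forall k, C1 (phi k))
  (phi_rank : forall z : 'I_m -> R, injective z ->
    full_rank (\matrix_(k < K, j < m) phi k (z j)))
  (data_nondeg : nondegenerate_data (phi (Ordinal hK)) x y)
  (disp : measure_display) (Omega : measurableType disp)
  (P : probability Omega R)
  (mu : probability (measurableTypeR R) R)
  (mu_cont : continuous_law mu)
  (mu_sym : symmetric_law mu)
  (c : 'I_N -> {RV P >-> R})
  (v : 'I_N -> {RV P >-> d.+1.-tuple R})
  (c_law : forall (i : 'I_N) (A : set R), measurable A ->
    distribution P (c i) A = mu A)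
  (v_law : forall i : 'I_N, std_normal_law (distribution P (v i)))
  (cv_indep : mutually_independent P (fun s : 'I_N + 'I_N =>
    match s with
    | inl i => generated_sigma (c i)
    | inr i => generated_sigma (v i)
    end)) :
  let L_FF := square_loss (ff_net (phi (Ordinal hK))) x y in
  let L_K := square_loss (kron_net phi) x y in
  {ae P, forall w : Omega,
    forall (theta_FF : R -> 'rV[R]_(N + (N * d + N)))
           (theta_K : R -> 'rV[R]_(N + (N * d + N) + (K + K))),
    gradient_flow L_FF theta_FF ->
    theta_FF 0 = ff_init (c ^~ w) (v ^~ w) ->
    gradient_flow L_K theta_K ->
    theta_K 0 = kron_init K (c ^~ w) (v ^~ w) ->
    exists T : R, 0 < T /\
      forall t : R, 0 < t < T -> L_K (theta_K t) < L_FF (theta_FF t)}.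
Proof.
move=> L_FF L_K.
have phi_continuous k : continuous (phi k).
  by move=> z; apply: differentiable_continuous; exact: differentiable_phi.
have indep : mutually_independent P (init_sigma c v) by [].
(* The almost sure event concerns the initialization alone; for each outcome in it the rest is
   deterministic and holds for every pair of flows. *)
apply: filterS (alpha_grad_ae_neq0 mu_cont c_law v_law indep phi_continuous hmK phi_rank
  (Ordinal hN) (Ordinal hm) data_nondeg) => w [k grad_k] theta_FF theta_K flow_FF FF0 flow_K K0.
have {}K0 : theta_K 0 = kron_point (theta_FF 0) by rewrite K0 FF0.
apply: steeper_flow_below flow_FF flow_K _ _.
- exact: differentiable_ff_loss.
- exact: differentiable_kron_loss.
- by rewrite K0; exact/esym/kron_loss_point.
- rewrite K0 FF0; apply: (@kron_gradient_norm_gt _ _ _ _ _ _ _ _ _ _ _ k) => //.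
  apply: contra_neq grad_k => grad0; rewrite -[RHS]grad0.
  by apply: eq_bigr => j _; rewrite !ff_net_init.
Qed.
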